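(* Let $b\ge2$ be an integer and $p=(p_0,\dots,p_{b-1})$ a probability vector with $p\ne(b^{-1},\dots,b^{-1})$. Let $\nu$ be the distribution of $\sum_{j\ge1}\xi_jb^{-j}$ with $\xi_j$ i.i.d. of distribution $p$, let $g(x)=\left|\sum_{j=0}^{b-1}p_je(jx)\right|$ and $S_L(x)=\prod_{j=0}^{L-1}g(b^jx)$. Then for every $L\in\mathbb N$, \[ \frac{-\log\Big(\max_x b^{-L}\sum_{i=0}^{b^L-1}S_L(x+i/b^L)\Big)}{\log b^L}\le\hat\kappa_1(\nu)\le\frac{-\log\Big(\min_x b^{-L}\sum_{i=0}^{b^L-1}S_L(x+i/b^L)\Big)}{\log b^L}. \] Moreover, these upper and lower bounds converge to the same limit as $L\to\infty$.
   Context: $e(x)=e^{2\pi ix}$; $\hat\nu(\xi)=\int e(-\xi x)\,d\nu(x)$ for $\xi\in\mathbb Z$; $\hat\kappa_1(\nu)=\sup\{s\ge0:\ \exists C_s\text{ with }\sum_{\xi=0}^Q|\hat\nu(\xi)|\le C_sQ^{1-s}\text{ for all }Q\ge1\}$. The max and min are over $x\in\mathbb R$. *)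

(* Defs.v *)
From HB Require Import structures.
From mathcomp Require Export all_boot all_order all_algebra finmap complex.
From mathcomp Require Export all_classical all_reals all_analysis.

Set Implicit Arguments.
Unset Strict Implicit.
Unset Printing Implicit Defensive.

Import Order.TTheory GRing.Theory Num.Theory.
Import numFieldTopology.Exports numFieldNormedType.Exports.

Local Open Scope classical_set_scope.
Local Open Scope ring_scope.

Definition mutually_independent (d : measure_display) (T : measurableType d)
    (R : realType) (P : probability T R) (I : choiceType)
    (X : I -> {RV P >-> R}) : Prop :=
  forall (J : {fset I}) (B : I -> set R), (forall i, measurable (B i)) ->
    P (\bigcap_(i in [set` J]) X i @^-1` B i) =
      (\prod_(i <- J) P (X i @^-1` B i))%E.

Section fourier.
Context {R : realType}.

(* The modulus as an element of R: the norm of R[i] is R[i]-valued. *)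
Definition cmod (z : R[i]) : R := complex.Re `|z|.

Definition e (x : R) : R[i] := Complex (cos (2 * pi * x)) (sin (2 * pi * x)).

Definition Cintegral (nu : probability R R) (f : R -> R[i]) : R[i] :=
  Complex (Rintegral nu setT (fun x => complex.Re (f x)))
          (Rintegral nu setT (fun x => complex.Im (f x))).

Definition fourier (nu : probability R R) (xi : int) : R[i] :=
  Cintegral nu (fun x => e (- (xi%:~R * x))).

(* Supremum in the extended reals, so that it makes sense for every nu. *)
Definition kappa1 (nu : probability R R) : \bar R :=
  ereal_sup [set s%:E | s in [set s : R | 0 <= s /\
    exists C : R, forall Q : nat, (1 <= Q)%N ->
      \sum_(0 <= xi < Q.+1) cmod (fourier nu xi%:Z) <= C * Q%:R `^ (1 - s)]].

Definition is_max (f : R -> R) (M : R) : Prop :=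
  (exists x, f x = M) /\ forall x, f x <= M.

Definition is_min (f : R -> R) (m : R) : Prop :=
  (exists x, f x = m) /\ forall x, m <= f x.

Variables (b : nat) (p : 'I_b -> R).

Definition gfun (x : R) : R :=
  cmod (\sum_(j < b) (p j)%:C%C * e (j%:R * x)).

Definition Sfun (L : nat) (x : R) : R :=
  \prod_(j < L) gfun (b%:R ^+ j * x).

Definition avgS (L : nat) (x : R) : R :=
  (b%:R ^+ L)^-1 * \sum_(i < b ^ L) Sfun L (x + i%:R / b%:R ^+ L).

End fourier.

(* Main.v *)
Require Import Defs.
From mathcomp Require Import measurable_realfun ring lra.
Import Order.TTheory GRing.Theory Num.Theory.
Import numFieldTopology.Exports numFieldNormedType.Exports.
Set Implicit Arguments.
Unset Strict Implicit.
Unset Printing Implicit Defensive.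
Local Open Scope classical_set_scope.
Local Open Scope ring_scope.

(* The modulus of the Fourier coefficient of nu at k is the infinite product
   phi k = g(k / b) g(k / b^2) ..., and phi (i + b^n j) = S_n(i / b^n) phi
   (i / b^n + j).  Hence the sum of phi over [0, b^n) is at most b^n avgS n 0;
   as soon as the sum of phi (u + a) over 0 <= a < b^k is bounded below for u in
   [0, 1], the sum of phi over [0, b^(n+k)) is also at least a constant times
   b^n avgS n 0.  Since avgS is sub- and supermultiplicative in the sense that
   m_L^n <= avgS (L n) 0 <= M_L^n, both bounds on kappa1 follow.

   The lower bound on the sums of phi uses that p is not uniform: inverting a
   discrete Fourier transform of length b shows that at least two of the b
   preimages (u + i) / b are not zeros of g, so at least 2^k of the b^k
   preimages of order k survive, which for large k exceeds the number of zeros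
   of phi in [0, 1].

   For the limit, S_L is the modulus of a trigonometric polynomial with b^L
   frequencies.  Lagrange interpolation at b^L equidistant nodes with the
   Dirichlet kernel gives M_L <= 8 (1 + L log b) m_L, so that the two bounds,
   which enclose kappa1, have a difference of order log L / L. *)

(** * Modulus and exponential *)

Section modulus.
Context {R : realType}.
Implicit Types z w : R[i].

Lemma norm_cmod z : `|z| = (cmod z)%:C%C.
Proof. by rewrite /cmod normc_def. Qed.

Lemma cmodE z : cmod z = Num.sqrt (complex.Re z ^+ 2 + complex.Im z ^+ 2).
Proof. by rewrite /cmod normc_def. Qed.

Lemma cmod_ge0 z : 0 <= cmod z.
Proof. by rewrite cmodE sqrtr_ge0. Qed.

Lemma cmodM z w : cmod (z * w) = cmod z * cmod w.
Proof. by apply: complexI; rewrite -norm_cmod normrM !norm_cmod -rmorphM. Qed.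

Lemma cmod0 : cmod (0 : R[i]) = 0.
Proof. by rewrite /cmod normr0. Qed.

Lemma cmod1 : cmod (1 : R[i]) = 1.
Proof. by rewrite /cmod normr1. Qed.

Lemma cmod_eq0 z : (cmod z == 0) = (z == 0).
Proof.
by rewrite -(normr_eq0 z) norm_cmod -(inj_eq (@complexI R)).
Qed.

Lemma cmodN z : cmod (- z) = cmod z.
Proof. by rewrite /cmod normrN. Qed.

Lemma cmodD z w : cmod (z + w) <= cmod z + cmod w.
Proof. by rewrite -lecR rmorphD /= -!norm_cmod ler_normD. Qed.

Lemma cmodBC z w : cmod (z - w) = cmod (w - z).
Proof. by rewrite -cmodN opprB. Qed.

Lemma cmod_dist z w : `|cmod z - cmod w| <= cmod (z - w).
Proof.
have h (u v : R[i]) : cmod u - cmod v <= cmod (u - v).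
  by have := cmodD (u - v) v; rewrite subrK lerBlDr.
by rewrite ler_norml lerNl opprB h cmodBC h.
Qed.

Lemma cmod_sum (I : Type) (r : seq I) (Q : pred I) (F : I -> R[i]) :
  cmod (\sum_(i <- r | Q i) F i) <= \sum_(i <- r | Q i) cmod (F i).
Proof.
elim/big_rec2: _ => [|i x y _ h]; first by rewrite cmod0.
by apply: le_trans (cmodD _ _) _; rewrite lerD2l.
Qed.

Lemma cmod_prod (I : Type) (r : seq I) (Q : pred I) (F : I -> R[i]) :
  cmod (\prod_(i <- r | Q i) F i) = \prod_(i <- r | Q i) cmod (F i).
Proof.
by elim/big_rec2: _ => [|i x y _ <-]; [rewrite cmod1|rewrite cmodM].
Qed.

Lemma cmod_real (x : R) : 0 <= x -> cmod x%:C%C = x.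
Proof. by move=> x0; rewrite cmodE /= expr0n addr0 sqrtr_sqr ger0_norm. Qed.

Lemma cmod_nat n : cmod (n%:R : R[i]) = n%:R.
Proof. by rewrite -(rmorph_nat (real_complex R)) cmod_real. Qed.

Lemma cmod_inv z : cmod z^-1 = (cmod z)^-1.
Proof. by apply: complexI; rewrite -norm_cmod normfV norm_cmod fmorphV. Qed.

Lemma cmod_le_ReIm z : cmod z <= `|complex.Re z| + `|complex.Im z|.
Proof.
rewrite cmodE -(@ler_pXn2r _ 2) ?nnegrE ?sqrtr_ge0 ?addr_ge0 //.
rewrite sqr_sqrtr ?addr_ge0 ?sqr_ge0 // sqrrD !real_normK ?num_real //.
by rewrite lerD2r lerDl mulrn_wge0 // mulr_ge0.
Qed.

Lemma Im_le_cmod z : `|complex.Im z| <= cmod z.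
Proof.
rewrite cmodE -sqrtr_sqr; apply: ler_wsqrtr.
by rewrite lerDr sqr_ge0.
Qed.

End modulus.

Section exponential.
Context {R : realType}.
Implicit Types x y : R.

Lemma eD x y : e (x + y) = e x * e y.
Proof.
rewrite /e mulrDr cosD sinD; apply/eqP; rewrite eq_complex /=.
by apply/andP; split; apply/eqP; ring.
Qed.

Lemma e0 : e (0 : R) = 1.
Proof. by rewrite /e mulr0 cos0 sin0. Qed.

Lemma cmod_e x : cmod (e x) = 1.
Proof. by rewrite cmodE /= cos2Dsin2 sqrtr1. Qed.

Lemma e_neq0 x : e x != 0.
Proof. by rewrite -cmod_eq0 cmod_e oner_neq0. Qed.

Lemma eN x : e (- x) = (e x)^-1.
Proof.
by apply: (mulfI (e_neq0 x)); rewrite -eD subrr e0 divff ?e_neq0.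
Qed.

Lemma eM_nat n x : e (n%:R * x) = e x ^+ n.
Proof.
elim: n => [|n IH]; first by rewrite mul0r e0 expr0.
by rewrite -natr1 mulrDl mul1r eD IH exprSr.
Qed.

Lemma e1 : e (1 : R) = 1.
Proof. by rewrite /e mulr1 mulr_natl cos2pi sin2pi. Qed.

Lemma e_nat n : e (n%:R : R) = 1.
Proof. by rewrite -[n%:R]mulr1 eM_nat e1 expr1n. Qed.

Lemma eDn x n : e (x + n%:R) = e x.
Proof. by rewrite eD e_nat mulr1. Qed.

Lemma e_sum (I : Type) (r : seq I) (F : I -> R) :
  e (\sum_(i <- r) F i) = \prod_(i <- r) e (F i).
Proof.
elim/big_rec2: _ => [|i x y _ <-]; first by rewrite e0.
by rewrite eD.
Qed.

Lemma dist_cos_le x y : `|cos x - cos y| <= `|x - y|.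
Proof.
wlog xy : x y / y <= x.
  move=> H; have [/H //|/ltW/H] := leP y x.
  by rewrite distrC (distrC y).
have [|c _ ->] := @MVT_segment R cos (fun x => - sin x) y x xy.
  exact/continuous_subspaceT/continuous_cos.
rewrite normrM normrN ler_piMl // ler_norml.
by rewrite sin_geN1 sin_le1.
Qed.

Lemma dist_sin_le x y : `|sin x - sin y| <= `|x - y|.
Proof.
wlog xy : x y / y <= x.
  move=> H; have [/H //|/ltW/H] := leP y x.
  by rewrite distrC (distrC y).
have [|c _ ->] := @MVT_segment R sin cos y x xy.
  exact/continuous_subspaceT/continuous_sin.
by rewrite normrM ler_piMl // ler_norml cos_geN1 cos_le1.
Qed.

Lemma dist_e_le x y : cmod (e x - e y) <= 4 * pi * `|x - y|.
Proof.
have pi0 := pi_ge0 R.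
apply: le_trans (cmod_le_ReIm _) _; rewrite /=.
have -> : 4 * pi * `|x - y| = `|2 * pi * x - 2 * pi * y| *+ 2.
  by rewrite -mulrBr normrM ger0_norm ?mulr_ge0 // -mulr_natr; ring.
by rewrite mulr2n lerD // ?dist_cos_le ?dist_sin_le.
Qed.

(* [sin x = 2 sin (x/2) cos (x/2) >= x cos (x/2) ^ 2 = x (1 + cos x) / 2] *)
Lemma sin_ge_half x : 0 <= x <= pi / 2 -> x / 2 <= sin x.
Proof.
move=> /andP[x0 xpi]; have pi0 := pi_gt0 R.
have [||c] := @MVT_segment R sin cos 0 (x / 2); first by lra.
  exact/continuous_subspaceT/continuous_sin.
rewrite in_itv /= => /andP[c0 cx]; rewrite sin0 !subr0 => sx.
have chalf : 0 <= cos (x / 2) by apply: cos_ge0_pihalf; lra.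
have cc : cos (x / 2) <= cos c.
  by rewrite leNgt; apply/negP; rewrite ltr_cos ?in_itv /=; lra.
have cx0 : 0 <= cos x by apply: cos_ge0_pihalf; lra.
have xE : x = x / 2 *+ 2 by lra.
have -> : sin x = (cos (x / 2) * sin (x / 2)) *+ 2.
  by rewrite [in LHS]xE -sin_mulr2n.
have c2 : cos x = cos (x / 2) ^+ 2 *+ 2 - 1.
  by rewrite [in LHS]xE -cos_mulr2n.
have h : 1 / 2 <= cos (x / 2) * cos c by nra.
by rewrite sx; nra.
Qed.

(** The minimum is the distance to the nearest integer. Up to x = 1 / 2, use |e x - 1| = 2 sin (pi
    x) and [sin_ge_half]; beyond, reflect x to 1 - x. *)
Lemma dist_e1_ge x : 0 <= x <= 1 -> Num.min x (1 - x) <= cmod (e x - 1).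
Proof.
have pi2 : (2 : R) <= pi by apply: pi_ge2.
have main y : 0 <= y <= 1 / 2 -> y <= cmod (e y - 1).
  move=> /andP[y0 y1].
  have -> : e y - 1 = e (y / 2) * (e (y / 2) - e (- (y / 2))).
    by rewrite mulrBr -!eD subrr e0 -splitr.
  rewrite cmodM cmod_e mul1r.
  apply: le_trans (Im_le_cmod _); rewrite /= mulrN sinN opprK.
  have -> : 2 * pi * (y / 2) = pi * y by field.
  apply: le_trans (ler_norm _).
  have : pi * y / 2 <= sin (pi * y) by apply: sin_ge_half; nra.
  nra.
move=> /andP[x0 x1]; rewrite ge_min.
have [h|h] := leP x (1 / 2).
  by rewrite main ?x0.
apply/orP; right; apply: le_trans (main (1 - x) _) _; first by lra.
suff -> : e (1 - x) - 1 = - (e x - 1) * e (- x).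
  by rewrite cmodM cmod_e cmodN mulr1.
by rewrite eD e1 mul1r mulNr mulrBl -eD subrr e0 mul1r opprB.
Qed.

Lemma e_neq1 x : 0 < x < 1 -> e x != 1.
Proof.
move=> /andP[x0 x1]; rewrite -subr_eq0 -cmod_eq0 gt_eqF //.
apply: lt_le_trans (dist_e1_ge _); last by rewrite !ltW.
by rewrite lt_min x0 subr_gt0.
Qed.

Lemma e_inj : {in `[0, 1[ &, injective (@e R)}.
Proof.
move=> x y; rewrite !in_itv /=.
wlog xy : x y / x <= y.
  move=> H xI yI exy; have [h|h] := leP x y; first exact: H.
  by apply/esym/H => //; apply: ltW.
move=> /andP[x0 x1] /andP[y0 y1] exy; apply/eqP.
rewrite eq_le xy /= leNgt; apply/negP => lt_xy.
have /eqP[] : e (y - x) != 1 by apply: e_neq1; lra.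
by rewrite eD eN -exy divff ?e_neq0.
Qed.

End exponential.

(** * Equidistant sampling *)

(** With N and M powers of b, this separates the low and high base-b digits of an index. *)
Lemma sum_ord_mul (V : nmodType) (N M : nat) (F : nat -> V) :
  \sum_(i < N * M) F i = \sum_(j < M) \sum_(i < N) F (i + N * j)%N.
Proof.
elim: M => [|M IH]; first by rewrite muln0 !big_ord0.
rewrite big_ord_recr /= -IH mulnSr -!(big_mkord xpredT).
rewrite (@big_cat_nat _ _ _ (N * M)) ?leq_addr //=; congr (_ + _).
by rewrite -{1}[(N * M)%N]add0n big_addn addKn big_mkord.
Qed.

Section equidistant.
Context {R : realType} (N : nat) (N0 : (0 < N)%N).

Let NR : (N%:R : R) != 0. Proof. by rewrite pnatr_eq0 -lt0n. Qed.
Let NR0 : 0 < (N%:R : R). Proof. by rewrite ltr0n. Qed.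

Section periodic.
Variables (V : nmodType) (psi : R -> V).
Hypothesis psi1 : forall x, psi (x + 1) = psi x.

(** By periodicity, a shift by one node is a cyclic permutation: the last node wraps round to the
    first. *)
Lemma sum_shift_nat (m : nat) t :
  \sum_(i < N) psi (t + m%:R / N%:R + i%:R / N%:R) =
  \sum_(i < N) psi (t + i%:R / N%:R).
Proof.
elim: m t => [|m IH] t; first by rewrite mul0r addr0.
rewrite -[in RHS]IH -(prednK N0) big_ord_recr [RHS]big_ord_recl /= addrC.
rewrite prednK //; congr (_ + _).
  rewrite -[RHS]psi1; congr psi.
  have -> : (N%:R : R) = N.-1%:R + 1 by rewrite natr1 prednK.
  by rewrite -[m.+1%:R]natr1; field; rewrite natr1 prednK.
apply: eq_bigr => i _; congr psi; rewrite /bump /= add1n -!natr1.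
by rewrite !mulrDl !mul1r -!addrA; congr (_ + (_ + _)); rewrite addrC.
Qed.

Lemma sum_shift_int (k : int) t :
  \sum_(i < N) psi (t + k%:~R / N%:R + i%:R / N%:R) =
  \sum_(i < N) psi (t + i%:R / N%:R).
Proof.
case: k => m; first exact: sum_shift_nat.
rewrite -[LHS](sum_shift_nat m.+1); apply: eq_bigr => i _; congr (psi (_ + _)).
by rewrite NegzE rmorphN /= mulNr subrK.
Qed.

End periodic.

(** For r != s the terms form a geometric progression whose ratio is an N-th root of unity other
    than 1. *)
Lemma sum_roots_of_unity (r s : nat) (x : R) : (r < N)%N -> (s < N)%N ->
  \sum_(i < N) e (s%:R * (x + i%:R / N%:R)) * e (- (r%:R * (x + i%:R / N%:R)))
  = (N%:R *+ (s == r) : R[i]).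
Proof.
move=> rN sN; case: eqVneq => [->|sr].
  under eq_bigr do rewrite -eD subrr e0.
  by rewrite sumr_const card_ord mulr1n.
set w : R[i] := e (s%:R / N%:R) * e (- (r%:R / N%:R)).
have w1 : w - 1 != 0.
  apply: contraNneq sr => /eqP; rewrite subr_eq0 /w => /eqP w1.
  have es : e (s%:R / N%:R) = e (r%:R / N%:R :> R).
    by rewrite -[LHS]mulr1 -(e0 (R := R)) -(subrr (r%:R / N%:R)) addrC eD
      mulrA w1 mul1r.
  have inI k : (k < N)%N -> (k%:R / N%:R : R) \in `[0, 1[.
    by move=> kN; rewrite in_itv /= divr_ge0 //= ltr_pdivrMr // mul1r ltr_nat.
  have /(mulIf (invr_neq0 NR))/eqP := e_inj (inI _ sN) (inI _ rN) es.
  by rewrite eqr_nat.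
have wN : w ^+ N = 1.
  rewrite exprMn -!eM_nat mulrN eN.
  have NK k : N%:R * (k%:R / N%:R) = k%:R :> R by rewrite mulrC divfK.
  by rewrite !NK !e_nat invr1 mulr1.
transitivity (e (s%:R * x) * e (- (r%:R * x)) * \sum_(i < N) w ^+ i).
  rewrite mulr_sumr; apply: eq_bigr => i _.
  by rewrite exprMn -!eM_nat -!eD; congr e; ring.
suff -> : \sum_(i < N) w ^+ i = 0 by rewrite mulr0.
by apply: (mulfI w1); rewrite -subrX1 wN subrr mulr0.
Qed.

Section trigonometric_polynomial.
Variables (c : nat -> R[i]) (F : R -> R[i]).
Hypothesis FE : forall x, F x = \sum_(r < N) c r * e (r%:R * x).

(** Discrete Fourier inversion: after expanding F, orthogonality leaves only the frequency s = r. *)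
Lemma coef_sample (r : nat) x : (r < N)%N ->
  c r = N%:R^-1 * \sum_(i < N) F (x + i%:R / N%:R) *
                               e (- (r%:R * (x + i%:R / N%:R))).
Proof.
move=> rN; under eq_bigr do rewrite FE mulr_suml.
rewrite exchange_big /=.
under eq_bigr => s _.
  under eq_bigr do rewrite -mulrA.
  rewrite -mulr_sumr sum_roots_of_unity //; over.
rewrite (bigD1 (Ordinal rN)) //= eqxx mulr1n big1 ?addr0; last first.
  by move=> s; rewrite -val_eqE /= => /negbTE ->; rewrite mulr0.
by rewrite mulrC mulfK // pnatr_eq0 -lt0n.
Qed.

(** The frequencies are those of F, 0 to N - 1, rather than symmetric about 0; the normalisation
    makes the value at 0 equal to 1. *)
Definition dirichlet (t : R) : R[i] := N%:R^-1 * \sum_(r < N) e (r%:R * t).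

Lemma interpolation x y :
  F y = \sum_(i < N) F (x + i%:R / N%:R) * dirichlet (y - (x + i%:R / N%:R)).
Proof.
rewrite FE; under eq_bigr => r _.
  rewrite (coef_sample x) // -mulrA mulr_suml mulr_sumr; over.
rewrite exchange_big /=; apply: eq_bigr => i _.
rewrite /dirichlet !mulr_sumr; apply: eq_bigr => r _.
rewrite mulrBr eD; ring.
Qed.

End trigonometric_polynomial.

Lemma dirichletD1 t : dirichlet (t + 1) = dirichlet t.
Proof.
rewrite /dirichlet; congr (_ * _); apply: eq_bigr => r _.
by rewrite mulrDr mulr1 eDn.
Qed.

Lemma dirichlet_le1 t : cmod (dirichlet t) <= 1.
Proof.
rewrite cmodM cmod_inv cmod_nat ler_pdivrMl // mulr1.
apply: le_trans (cmod_sum _ _ _) _.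
by under eq_bigr do rewrite cmod_e; rewrite sumr_const card_ord.
Qed.

(** The geometric sum has modulus at most 2 / |e u - 1|. The larger of 1 / u and 1 / (1 - u) is
    replaced by their sum, so that each can be summed over the nodes separately. *)
Lemma dirichlet_decay u : 0 < u < 1 ->
  cmod (dirichlet u) <= 2 / N%:R * (u^-1 + (1 - u)^-1).
Proof.
move=> /andP[u0 u1]; have v0 : 0 < 1 - u by rewrite subr_gt0.
rewrite /dirichlet cmodM cmod_inv cmod_nat -mulrA mulrCA ler_pM2l ?invr_gt0 //.
under eq_bigr do rewrite eM_nat.
set z := cmod _.
have hm : 0 < Num.min u (1 - u) by rewrite lt_min u0.
have he : Num.min u (1 - u) <= cmod (e u - 1).
  by apply: dist_e1_ge; rewrite !ltW.
have hz : z * cmod (e u - 1) <= 2.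
  rewrite -cmodM mulrC -subrX1 -eM_nat; apply: le_trans (cmodD _ _) _.
  by rewrite cmodN cmod_e cmod1.
have z0 : 0 <= z := cmod_ge0 _.
apply: (@le_trans _ _ (2 * (Num.min u (1 - u))^-1)).
  by rewrite ler_pdivlMr //; apply: le_trans hz; rewrite ler_wpM2l.
rewrite ler_pM2l //; case: (leP u (1 - u)) => _.
  by rewrite lerDl invr_ge0 ltW.
by rewrite lerDr invr_ge0 ltW.
Qed.

(** At an inner node u = t + i / N one has N u >= i and N (1 - u) >= N - i - 1, which are at least
    half of i + 1 and of N - i. *)
Lemma dirichlet_node_le (t : R) (i : nat) : (i < N)%N -> 0 <= t < N%:R^-1 ->
  cmod (dirichlet (t + i%:R / N%:R)) <= 4 * (i.+1%:R^-1 + (N - i)%:R^-1).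
Proof.
move=> iN /andP[t0 tN].
have i0 : 0 < (i.+1%:R^-1 : R) by rewrite invr_gt0 ltr0n.
have Ni0 : 0 < ((N - i)%:R^-1 : R) by rewrite invr_gt0 ltr0n subn_gt0.
(* The first and the last node may lie arbitrarily close to an integer; there the trivial bound 1 is
   used. *)
have [->|ipos] := posnP i.
  apply: le_trans (dirichlet_le1 _) _; rewrite subn0 invr1.
  by move: Ni0; rewrite ?invr_gt0; nra.
have [iN1|iN1] := leqP N i.+1.
  have NiE : N = i.+1 by apply/eqP; rewrite eqn_leq iN1.
  have -> : (N - i)%N = 1%N by rewrite NiE subSnn.
  have le4 (a b : R) : 0 < a -> 1 <= b -> 1 <= 4 * (a + b) by lra.
  by apply: le_trans (dirichlet_le1 _) (le4 _ _ i0 _); rewrite invr1.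
set u := t + _.
have uE : N%:R * u = N%:R * t + i%:R by rewrite /u mulrDr mulrCA divff // mulr1.
have tN' : N%:R * t < 1 by rewrite mulrC -ltr_pdivlMr // mul1r.
have t0' : 0 <= N%:R * t by rewrite mulr_ge0.
have i1 : (1 : R) <= i%:R by rewrite ler1n.
have iN2 : (i%:R + 2 : R) <= N%:R by rewrite -natrD ler_nat addn2.
have u0 : 0 < u by rewrite -(pmulr_rgt0 _ NR0) uE; lra.
have u1 : u < 1 by rewrite -(ltr_pM2l NR0) uE; lra.
apply: le_trans (dirichlet_decay _) _; first by rewrite u0.
have -> : 2 / N%:R * (u^-1 + (1 - u)^-1) =
    2 * (N%:R * u)^-1 + 2 * (N%:R * (1 - u))^-1.
  by field; rewrite !gt_eqF // subr_gt0.
rewrite mulrBr mulr1 uE mulrDr natrB; last exact: ltnW.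
have h (a b : R) : 0 < b -> b <= 2 * a -> 2 * a^-1 <= 4 * b^-1.
  move=> b0 ba; have a0 : 0 < a by lra.
  by rewrite ler_pdivrMr // mulrAC ler_pdivlMr //; lra.
have iS : (i.+1%:R : R) = i%:R + 1 by rewrite natr1.
by apply: lerD; apply: h; rewrite ?iS; lra.
Qed.

Lemma sum_harmonic_le (n : nat) : (0 < n)%N ->
  \sum_(i < n) i.+1%:R^-1 <= 1 + ln n%:R :> R.
Proof.
case: n => // n _; elim: n => [|n IH].
  by rewrite big_ord_recr big_ord0 /= ln1 invr1 add0r addr0.
rewrite big_ord_recr /=; apply: le_trans (lerD IH (lexx _)) _.
rewrite -addrA lerD2l -lerBrDl.
have n2 : (1 : R) <= n.+1%:R by rewrite ler1n.
have hn : (n.+2%:R : R) = n.+1%:R + 1 by rewrite natr1.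
(* ln (1 + x) <= x at x = - 1 / (n + 2) shows that ln grows by at least 1 / (n + 2) from n + 1 to n
   + 2. *)
have := @le_ln1Dx R (- n.+2%:R^-1).
have -> : 1 - n.+2%:R^-1 = n.+1%:R / n.+2%:R :> R by rewrite hn; field; lra.
rewrite ln_div ?posrE ?ltr0n // => H.
suff : -1 < - n.+2%:R^-1 :> R by move/H => h; rewrite -lerN2 opprB.
by rewrite ltrN2 invf_lt1 ?ltr0n // ltr1n.
Qed.

Lemma lebesgue_constant_le (t : R) : 0 <= t < N%:R^-1 ->
  \sum_(i < N) cmod (dirichlet (t + i%:R / N%:R)) <= 8 * (1 + ln N%:R).
Proof.
move=> tI; have := sum_harmonic_le N0; set H := \sum_(i < N) _ => hH.
apply: (@le_trans _ _ (\sum_(i < N) 4 * (i.+1%:R^-1 + (N - i)%:R^-1))).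
  by apply: ler_sum => i _; apply: dirichlet_node_le.
rewrite -mulr_sumr big_split /= -/H.
suff -> : \sum_(i < N) (N - i)%:R^-1 = H :> R by lra.
rewrite (reindex_inj rev_ord_inj) /=; apply: eq_bigr => i _.
by rewrite subKn.
Qed.

(* Interpolating the samples at [y + i / N] from those at [x + i / N] costs
   only the Lebesgue constant of the Dirichlet kernel, which is logarithmic. *)
Lemma sample_compare (c : nat -> R[i]) (F : R -> R[i]) x y :
  (forall x, F x = \sum_(r < N) c r * e (r%:R * x)) ->
  \sum_(i < N) cmod (F (y + i%:R / N%:R)) <=
  8 * (1 + ln N%:R) * \sum_(i < N) cmod (F (x + i%:R / N%:R)).
Proof.
move=> FE.
have F1 z : F (z + 1) = F z.
  by rewrite !FE; apply: eq_bigr => r _; rewrite mulrDr mulr1 eDn.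
(* Removing k spacings permutes the nodes modulo 1 and leaves an offset in [0, 1 / N), as
   [lebesgue_constant_le] requires. *)
pose k := Num.floor ((y - x) * N%:R).
rewrite -(sum_shift_int (psi := fun z => cmod (F z)) _ (- k));
  last by move=> z; rewrite F1.
set y' := y + _.
have yx : 0 <= y' - x < N%:R^-1.
  have /andP[k1 k2] := floor_itv ((y - x) * N%:R).
  have -> : y' - x = ((y - x) * N%:R - k%:~R) / N%:R.
    by rewrite /y' rmorphN /=; field.
  rewrite divr_ge0 ?subr_ge0 ?ler0n //= -[ltRHS]mul1r ltr_pM2r ?invr_gt0 //.
  by rewrite ltrBlDl -[1]/(1%:~R) -rmorphD.
apply: (@le_trans _ _ (\sum_(j < N) \sum_(i < N) cmod (F (x + i%:R / N%:R)) *
    cmod (dirichlet (y' - x - i%:R / N%:R + j%:R / N%:R)))).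
  apply: ler_sum => j _; rewrite (interpolation FE x).
  apply: le_trans (cmod_sum _ _ _) _; apply: ler_sum => i _.
  rewrite cmodM le_eqVlt; apply/orP; left; apply/eqP.
  by congr (_ * cmod (dirichlet _)); ring.
rewrite exchange_big mulr_sumr /=; apply: ler_sum => i _.
rewrite -mulr_sumr mulrC ler_wpM2r ?cmod_ge0 //.
rewrite -(sum_shift_nat (psi := fun z => cmod (dirichlet z)) _ i); last first.
  by move=> z; rewrite dirichletD1.
by rewrite subrK; apply: lebesgue_constant_le.
Qed.

End equidistant.

(** * The averages avgS *)

Lemma lipschitz_continuous {R : realType} (K : R) (f : R -> R) :
  (forall x y, `|f x - f y| <= K * `|x - y|) -> continuous f.
Proof.
move=> fK x; have K0 : 0 < `|K| + 1 by rewrite ltr_wpDl.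
apply/cvgrPdist_le => eps eps0; near=> y.
apply: le_trans (fK _ _) _.
apply: (@le_trans _ _ ((`|K| + 1) * `|x - y|)).
  by rewrite ler_wpM2r // (le_trans (ler_norm _)) // lerDl.
rewrite -ler_pdivlMl //; near: y.
have eK : 0 < (`|K| + 1)^-1 * eps by rewrite mulr_gt0 ?invr_gt0.
by apply/nbhs_ballP; exists ((`|K| + 1)^-1 * eps) => // y /= /ltW.
Unshelve. all: by end_near. Qed.

Lemma dist_prod_le {R : realType} (I : Type) (r : seq I) (F G : I -> R) :
  (forall i, 0 <= F i <= 1) -> (forall i, 0 <= G i <= 1) ->
  `|\prod_(i <- r) F i - \prod_(i <- r) G i| <= \sum_(i <- r) `|F i - G i|.
Proof.
move=> F01 G01; elim: r => [|i r IH]; first by rewrite !big_nil subrr normr0.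
rewrite !big_cons.
set A := \prod_(_ <- _) _; set B := \prod_(_ <- _) _.
have -> : F i * A - G i * B = (F i - G i) * A + G i * (A - B) by ring.
apply: le_trans (ler_normD _ _) _; rewrite !normrM; apply: lerD.
  rewrite ler_piMr // ger0_norm ?prodr_ge0 //; last first.
    by move=> j _; case/andP: (F01 j).
  exact: prodr_ile1.
have /andP[G0 G1] := G01 i.
by rewrite ger0_norm //; apply: le_trans IH; rewrite ler_piMl.
Qed.


Section product.
Context {R : realType} (b : nat) (p : 'I_b -> R).
Hypotheses (hb : (2 <= b)%N) (p_ge0 : forall k, 0 <= p k).
Hypothesis p_sum1 : \sum_(k < b) p k = 1.

Let b_gt0 : (0 < b)%N. Proof. exact: ltnW. Qed.
Let bX_gt0 L : (0 < b ^ L)%N. Proof. by rewrite expn_gt0 b_gt0. Qed.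
Let bR_gt0 : 0 < (b%:R : R). Proof. by rewrite ltr0n. Qed.
Let bR_neq0 : (b%:R : R) != 0. Proof. by rewrite gt_eqF. Qed.
Let bRX_gt0 L : 0 < (b%:R ^+ L : R). Proof. by rewrite exprn_gt0. Qed.
Let bRX_neq0 L : (b%:R ^+ L : R) != 0. Proof. by rewrite gt_eqF. Qed.

(** Kept complex because inversion and interpolation apply to the trigonometric polynomial itself,
    not to its modulus [gfun]. *)
Definition digit_char (x : R) : R[i] :=
  \sum_(j < b) (p j)%:C%C * e (j%:R * x).

Lemma gfunE x : gfun p x = cmod (digit_char x).
Proof. by []. Qed.

Lemma gfun_ge0 x : 0 <= gfun p x.
Proof. exact: cmod_ge0. Qed.

Lemma gfun_le1 x : gfun p x <= 1.
Proof.
apply: le_trans (cmod_sum _ _ _) _; rewrite -p_sum1; apply: ler_sum => j _.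
by rewrite cmodM cmod_e mulr1 cmod_real.
Qed.

Lemma digit_char0 : digit_char 0 = 1.
Proof.
rewrite /digit_char; under eq_bigr do rewrite mulr0 e0 mulr1.
by rewrite -(rmorph_sum (real_complex R)) p_sum1.
Qed.

Lemma gfun0 : gfun p 0 = 1.
Proof. by rewrite gfunE digit_char0 cmod1. Qed.

Lemma digit_charDn x n : digit_char (x + n%:R) = digit_char x.
Proof. by apply: eq_bigr => j _; rewrite mulrDr -natrM eDn. Qed.

Lemma gfunDn x n : gfun p (x + n%:R) = gfun p x.
Proof. by rewrite !gfunE digit_charDn. Qed.

Lemma gfunN x : gfun p (- x) = gfun p x.
Proof.
suff -> : gfun p (- x) = cmod (digit_char x)^*%C by rewrite /cmod normcJ.
have cM (z w : R[i]) : (z * w)^*%C = z^*%C * w^*%C by exact: rmorphM.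
have cD (z w : R[i]) : (z + w)^*%C = z^*%C + w^*%C by exact: rmorphD.
rewrite gfunE /digit_char (big_morph _ cD (conjc0 R)).
congr cmod; apply: eq_bigr => j _.
rewrite cM conjc_real mulrN; congr (_ * _).
by rewrite /e /= mulrN cosN sinN.
Qed.

Definition gfun_lip : R := 4 * pi * b%:R.

Lemma gfun_lip_ge0 : 0 <= gfun_lip.
Proof. by rewrite !mulr_ge0 // pi_ge0. Qed.

Lemma dist_gfun_le x y : `|gfun p x - gfun p y| <= gfun_lip * `|x - y|.
Proof.
apply: le_trans (cmod_dist _ _) _; rewrite -sumrB.
apply: le_trans (cmod_sum _ _ _) _.
apply: (@le_trans _ _ (\sum_(j < b) p j * (gfun_lip * `|x - y|))); last first.
  by rewrite -mulr_suml p_sum1 mul1r.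
apply: ler_sum => j _; rewrite -mulrBr cmodM cmod_real // ler_wpM2l //.
apply: le_trans (dist_e_le _ _) _; rewrite -mulrBr normrM /gfun_lip.
rewrite -[leRHS]mulrA ler_wpM2l ?mulr_ge0 ?pi_ge0 // ler_wpM2r //.
by rewrite ger0_norm // ler_nat ltnW.
Qed.

Lemma Sfun_ge0 L x : 0 <= Sfun p L x.
Proof. by apply: prodr_ge0 => j _; apply: gfun_ge0. Qed.

Lemma Sfun_le1 L x : Sfun p L x <= 1.
Proof. by apply: prodr_ile1 => j _; rewrite gfun_ge0 gfun_le1. Qed.

Lemma Sfun_at0 L : Sfun p L 0 = 1.
Proof. by apply: big1 => j _; rewrite mulr0 gfun0. Qed.

Lemma SfunDn L x n : Sfun p L (x + n%:R) = Sfun p L x.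
Proof. by apply: eq_bigr => j _; rewrite mulrDr -natrX -natrM gfunDn. Qed.

Lemma dist_Sfun_le L x y : `|Sfun p L x - Sfun p L y| <=
  (\sum_(j < L) gfun_lip * b%:R ^+ j) * `|x - y|.
Proof.
apply: le_trans (dist_prod_le _ _ _) _ => [j|j|].
- by rewrite gfun_ge0 gfun_le1.
- by rewrite gfun_ge0 gfun_le1.
rewrite mulr_suml; apply: ler_sum => j _.
apply: le_trans (dist_gfun_le _ _) _.
by rewrite -mulrBr normrM (ger0_norm (ltW (bRX_gt0 j))) mulrA.
Qed.

Lemma SfunD L K x : Sfun p (K + L) x = Sfun p K x * Sfun p L (b%:R ^+ K * x).
Proof.
rewrite /Sfun big_split_ord /=; congr (_ * _); apply: eq_bigr => j _.
by rewrite exprD [b%:R ^+ K * _]mulrC mulrA.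
Qed.

(** On expanding the product, each frequency r receives the product of the weights of its base-b
    digits. *)
Lemma Sfun_trig_poly L : exists c : nat -> R[i], forall x,
  \prod_(j < L) digit_char (b%:R ^+ j * x) =
  \sum_(r < b ^ L) c r * e (r%:R * x).
Proof.
elim: L => [|L [c cE]].
  by exists (fun=> 1) => x; rewrite big_ord0 expn0 big_ord1 mul0r e0 mulr1.
(* The new factor supplies the leading digit r / b ^ L; the remainder holds the lower L digits. *)
pose c' r := c (r %% b ^ L)%N *
  (if insub (r %/ b ^ L)%N is Some k then (p k)%:C%C else 0).
exists c' => x; rewrite big_ord_recr /= cE expnSr.
rewrite (sum_ord_mul _ _ (fun r => c' r * e (r%:R * x))) mulr_sumr.
apply: eq_bigr => j _; rewrite mulr_suml; apply: eq_bigr => i _.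
rewrite /c' addnC mulnC modnMDl divnMDl ?bX_gt0 // modn_small // divn_small //.
rewrite addn0 valK.
have -> : (j * b ^ L + i)%:R * x = i%:R * x + j%:R * (b%:R ^+ L * x).
  by rewrite natrD natrM natrX; ring.
by rewrite eD; ring.
Qed.

Lemma SfunE L x : Sfun p L x = cmod (\prod_(j < L) digit_char (b%:R ^+ j * x)).
Proof. by rewrite cmod_prod. Qed.

(** The number b ^ L of sampling points equals the number of frequencies, so [sample_compare]
    applies with N = b ^ L. *)
Lemma avgS_le_avgS L x y :
  avgS p L y <= 8 * (1 + ln (b%:R ^+ L)) * avgS p L x.
Proof.
have [c cE] := Sfun_trig_poly L.
have := sample_compare (bX_gt0 L) x y cE.
rewrite /avgS mulrCA ler_pM2l ?invr_gt0 // natrX => h.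
under eq_bigr do rewrite SfunE.
by under [in leRHS]eq_bigr do rewrite SfunE.
Qed.

Lemma avgSD1 L x : avgS p L (x + 1) = avgS p L x.
Proof.
rewrite /avgS; congr (_ * _); apply: eq_bigr => i _.
by rewrite addrAC (SfunDn _ _ 1).
Qed.

Lemma avgSDz L x (k : int) : avgS p L (x + k%:~R) = avgS p L x.
Proof.
have H n y : avgS p L (y + n%:R) = avgS p L y.
  by elim: n => [|n IH]; rewrite ?addr0 // -natr1 addrA avgSD1.
case: k => n; first exact: H.
by rewrite NegzE rmorphN /= -[in RHS](subrK n.+1%:R x) H.
Qed.

Lemma continuous_avgS L : continuous (avgS p L).
Proof.
apply: (@lipschitz_continuous _ (\sum_(j < L) gfun_lip * b%:R ^+ j)) => x y.
rewrite /avgS -mulrBr -sumrB normrM.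
rewrite (ger0_norm (ltW _)) ?invr_gt0 // ler_pdivrMl //.
apply: le_trans (ler_norm_sum _ _ _) _.
set K := (\sum_(j < L) _) * _.
apply: (@le_trans _ _ (\sum_(i < b ^ L) K)).
  apply: ler_sum => i _; apply: le_trans (dist_Sfun_le _ _ _) _.
  by rewrite opprD addrACA subrr addr0.
by rewrite sumr_const card_ord -[K *+ _]mulr_natl natrX.
Qed.

Lemma avgS_reduce L x : exists2 y, y \in `[0, 1] & avgS p L x = avgS p L y.
Proof.
exists (x - (Num.floor x)%:~R); last by rewrite -rmorphN avgSDz.
have /andP[h1 h2] := floor_itv x.
by rewrite in_itv /= subr_ge0 h1 lerBlDr addrC -intrD1 ltW.
Qed.

Lemma avgS_max L : exists M, is_max (avgS p L) M.
Proof.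
have [|c cI cM] := @EVT_max R (avgS p L) 0 1 ler01.
  exact/continuous_subspaceT/continuous_avgS.
exists (avgS p L c); split; first by exists c.
by move=> x; have [y yI ->] := avgS_reduce L x; apply: cM.
Qed.

Lemma avgS_min L : exists m, is_min (avgS p L) m.
Proof.
have [|c cI cM] := @EVT_min R (avgS p L) 0 1 ler01.
  exact/continuous_subspaceT/continuous_avgS.
exists (avgS p L c); split; first by exists c.
by move=> x; have [y yI ->] := avgS_reduce L x; apply: cM.
Qed.

Lemma avgS_ge0 L x : 0 <= avgS p L x.
Proof.
rewrite mulr_ge0 ?invr_ge0 ?(ltW (bRX_gt0 _)) //.
by apply: sumr_ge0 => i _; apply: Sfun_ge0.
Qed.

Lemma avgS_le1 L x : avgS p L x <= 1.
Proof.
rewrite ler_pdivrMl // mulr1.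
apply: (@le_trans _ _ (\sum_(i < b ^ L) 1)).
  by apply: ler_sum => i _; exact: Sfun_le1.
by rewrite sumr_const card_ord natrX.
Qed.

Lemma avgS0_ge L : (b%:R ^+ L)^-1 <= avgS p L 0.
Proof.
rewrite -[leLHS]mulr1 ler_pM2l ?invr_gt0 //.
rewrite (bigD1 (Ordinal (bX_gt0 L))) //= mul0r addr0 Sfun_at0 lerDl.
by apply: sumr_ge0 => i _; apply: Sfun_ge0.
Qed.

(** Write the index as i + b ^ L j. By periodicity the factor S_L does not depend on j, and the sum
    over j is an average of S_K. *)
Lemma avgSD L K x : avgS p (K + L) x =
  (b%:R ^+ L)^-1 * \sum_(i < b ^ L)
    Sfun p L (b%:R ^+ K * x + i%:R / b%:R ^+ L) *
    avgS p K (x + i%:R / b%:R ^+ (K + L)).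
Proof.
rewrite {1}/avgS [X in X^-1 * _]exprD [X in X * _]invfM -mulrA mulrCA.
congr (_ * _).
have -> : (b ^ (K + L) = b ^ L * b ^ K)%N by rewrite addnC expnD.
rewrite (sum_ord_mul _ _ (fun i =>
  Sfun p (K + L) (x + i%:R / b%:R ^+ (K + L)))) exchange_big /=.
rewrite mulr_sumr; apply: eq_bigr => i _.
rewrite /avgS mulrCA; congr (_ * _); rewrite mulr_sumr; apply: eq_bigr => j _.
rewrite SfunD mulrC natrD natrM natrX; congr (_ * _).
  rewrite -[RHS](SfunDn _ _ j); congr (Sfun p L _).
  by rewrite exprD; field; rewrite !bRX_neq0.
congr (Sfun p K _); rewrite exprD.
by field; rewrite !bRX_neq0.
Qed.

Lemma avgSD_le L K M x : (forall y, avgS p K y <= M) ->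
  avgS p (K + L) x <= avgS p L (b%:R ^+ K * x) * M.
Proof.
move=> KM; rewrite avgSD [avgS p L _]/avgS -[leRHS]mulrA.
rewrite ler_pM2l ?invr_gt0 // mulr_suml.
by apply: ler_sum => i _; rewrite ler_wpM2l ?Sfun_ge0.
Qed.

Lemma avgSD_ge L K m x : (forall y, m <= avgS p K y) ->
  avgS p L (b%:R ^+ K * x) * m <= avgS p (K + L) x.
Proof.
move=> KM; rewrite avgSD [avgS p L _]/avgS -[leLHS]mulrA.
rewrite ler_pM2l ?invr_gt0 // mulr_suml.
by apply: ler_sum => i _; rewrite ler_wpM2l ?Sfun_ge0.
Qed.

Lemma avgS_L0 x : avgS p 0 x = 1.
Proof. by rewrite /avgS expn0 big_ord1 /Sfun big_ord0 expr0 invr1 mulr1. Qed.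

Lemma avgS_mul_le L n M x : (forall y, avgS p L y <= M) ->
  avgS p (L * n) x <= M ^+ n.
Proof.
move=> LM; elim: n x => [|n IH] x; first by rewrite muln0 avgS_L0.
rewrite mulnS; apply: le_trans (avgSD_le _ _ LM) _; rewrite exprSr.
by apply: ler_wpM2r => //; apply: le_trans (LM 0); apply: avgS_ge0.
Qed.

Lemma avgS_mul_ge L n m x : 0 <= m -> (forall y, m <= avgS p L y) ->
  m ^+ n <= avgS p (L * n) x.
Proof.
move=> m0 LM; elim: n x => [|n IH] x; first by rewrite muln0 avgS_L0.
rewrite mulnS; apply: le_trans (avgSD_ge _ _ LM); rewrite exprSr.
exact: ler_wpM2r.
Qed.

(** * Preimages that are not zeros of g *)

Hypothesis p_nonunif : p <> (fun=> b%:R^-1).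

(* If [digit_char] vanished at all the nodes [(y + i) / b] but one, inverting
   the discrete Fourier transform would give digits of equal probabilities. *)
Lemma exists_gfun_neq0 y (i0 : 'I_b) :
  exists2 i : 'I_b, i != i0 & gfun p ((y + i%:R) / b%:R) != 0.
Proof.
apply: contrapT => H; apply: p_nonunif.
pose c r : R[i] := if insub r is Some k then (p k)%:C%C else 0.
have cE x : digit_char x = \sum_(r < b) c r * e (r%:R * x).
  by apply: eq_bigr => r _; rewrite /c valK.
have Hz i : i != i0 -> digit_char (y / b%:R + i%:R / b%:R) = 0.
  move=> ii0; apply/eqP; rewrite -cmod_eq0 -gfunE -mulrDl.
  by apply: contrapT => /negP h; apply: H; exists i.
pose q := b%:R^-1 * gfun p (y / b%:R + i0%:R / b%:R).
have pq r : p r = q.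
  rewrite -[LHS]cmod_real //; have -> : (p r)%:C%C = c r by rewrite /c valK.
  rewrite (coef_sample b_gt0 cE (y / b%:R)) // (bigD1 i0) //= big1 => [|i /Hz ->].
    by rewrite addr0 !cmodM cmod_e mulr1 cmod_inv cmod_nat.
  by rewrite mul0r.
apply/funext => r; rewrite pq.
have := p_sum1; under eq_bigr do rewrite pq.
rewrite sumr_const card_ord => bq.
by apply: (mulfI bR_neq0); rewrite mulr_natl bq divff.
Qed.

Lemma count_gfun_neq0 y :
  2 <= \sum_(i < b) ((gfun p ((y + i%:R) / b%:R) != 0)%:R : R).
Proof.
have [i _ hi] := exists_gfun_neq0 y (Ordinal b_gt0).
have [j ji hj] := exists_gfun_neq0 y i.
rewrite (bigD1 i) // (bigD1 j) //= hi hj addrA -natrD lerDl.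
by apply: sumr_ge0 => k _.
Qed.

(** Induction on the tree of preimages: the index i + b j passes through (u + i) / b, where at least
    two i survive, and continues with j among the preimages of order k of that point. *)
Lemma count_Sfun_neq0 k u :
  2 ^+ k <= \sum_(i < b ^ k) ((Sfun p k ((u + i%:R) / b%:R ^+ k) != 0)%:R : R).
Proof.
elim: k u => [|k IH] u.
  by rewrite expn0 big_ord1 /Sfun big_ord0 oner_neq0.
rewrite expnS (sum_ord_mul _ _ (fun i =>
  ((Sfun p k.+1 ((u + i%:R) / b%:R ^+ k.+1) != 0)%:R : R))) exchange_big /=.
have eq1 (i : 'I_b) (j : 'I_(b ^ k)) :
    Sfun p k.+1 ((u + (i + b * j)%:R) / b%:R ^+ k.+1) =
    Sfun p k (((u + i%:R) / b%:R + j%:R) / b%:R ^+ k) *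
    gfun p ((u + i%:R) / b%:R).
  rewrite -addn1 SfunD /Sfun big_ord1 expr0 mul1r; congr (_ * _).
    apply: eq_bigr => l _; congr (gfun p (_ * _)).
    by rewrite natrD natrM exprD; field; rewrite ?bRX_neq0 ?bR_neq0.
  rewrite -[RHS](gfunDn _ j); congr (gfun p _).
  by rewrite natrD natrM exprD; field; rewrite ?bRX_neq0 ?bR_neq0.
under eq_bigr => i _ do under eq_bigr => j _ do
  rewrite eq1 mulf_eq0 negb_or -mulnb natrM.
under eq_bigr => i _ do rewrite -mulr_suml.
rewrite exprSr.
apply: (@le_trans _ _
  (\sum_(i < b) 2 ^+ k * ((gfun p ((u + i%:R) / b%:R) != 0)%:R : R))).
  by rewrite -mulr_sumr ler_wpM2l // ?exprn_ge0 // count_gfun_neq0.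
by apply: ler_sum => i _; rewrite ler_wpM2r // IH.
Qed.

(** At least 2 ^ L terms are nonzero, by [count_Sfun_neq0] at b ^ L x. This makes the logarithms of
    the extrema meaningful. *)
Lemma avgS_gt0 L x : 0 < avgS p L x.
Proof.
rewrite mulr_gt0 ?invr_gt0 // lt_def sumr_ge0 ?andbT; last first.
  by move=> i _; apply: Sfun_ge0.
apply/eqP => S0.
have /(_ _ isT)Sz := psumr_eq0P (fun i _ => Sfun_ge0 L _) S0.
have := count_Sfun_neq0 L (b%:R ^+ L * x).
rewrite big1 => [|i _]; first by rewrite leNgt exprn_gt0.
by rewrite mulrDl mulrC mulKf ?bRX_neq0 // Sz eqxx.
Qed.

End product.

(** * The infinite product *)

Section infinite_product.
Context {R : realType} (b : nat) (p : 'I_b -> R).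
Hypotheses (hb : (2 <= b)%N) (p_ge0 : forall k, 0 <= p k).
Hypothesis p_sum1 : \sum_(k < b) p k = 1.

Let b_gt0 : (0 < b)%N. Proof. exact: ltnW. Qed.
Let bR_gt0 : 0 < (b%:R : R). Proof. by rewrite ltr0n. Qed.
Let bRX_gt0 L : 0 < (b%:R ^+ L : R). Proof. by rewrite exprn_gt0. Qed.
Let bRX_neq0 L : (b%:R ^+ L : R) != 0. Proof. by rewrite gt_eqF. Qed.

(** Modulus at t of the Fourier transform of the law of the first n digits. *)
Definition Fprod (n : nat) (t : R) : R :=
  \prod_(j < n) gfun p (t / b%:R ^+ j.+1).

Lemma Sfun_Fprod n t : Sfun p n (t / b%:R ^+ n) = Fprod n t.
Proof.
rewrite /Sfun (reindex_inj rev_ord_inj); apply: eq_bigr => j _ /=.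
have -> : b%:R ^+ n = b%:R ^+ (n - j.+1) * b%:R ^+ j.+1 :> R.
  by rewrite -exprD subnK.
by congr gfun; field; rewrite !bRX_neq0.
Qed.

Lemma FprodD n k t : Fprod (n + k) t = Fprod n t * Fprod k (t / b%:R ^+ n).
Proof.
rewrite /Fprod big_split_ord /=; congr (_ * _); apply: eq_bigr => j _.
by rewrite -addnS exprD; congr gfun; field; rewrite !bRX_neq0.
Qed.

Lemma Fprod_ge0 n t : 0 <= Fprod n t.
Proof. by rewrite -Sfun_Fprod Sfun_ge0. Qed.

Lemma Fprod_le1 n t : Fprod n t <= 1.
Proof. by rewrite -Sfun_Fprod Sfun_le1. Qed.

Lemma Fprod_nonincreasing t :
  {homo Fprod ^~ t : n m / (n <= m)%N >-> m <= n}.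
Proof.
move=> n m /subnKC <-; rewrite FprodD ler_piMr ?Fprod_ge0 //.
exact: Fprod_le1.
Qed.

Definition phi (t : R) : R := limn (Fprod ^~ t).

Lemma cvg_Fprod t : Fprod n t @[n --> \oo] --> phi t.
Proof.
apply: nonincreasing_is_cvgn; first exact: Fprod_nonincreasing.
by exists 0 => _ [n _ <-]; apply: Fprod_ge0.
Qed.

Lemma phi_le_Fprod n t : phi t <= Fprod n t.
Proof.
apply: nonincreasing_cvgn_ge; first exact: Fprod_nonincreasing.
exact: cvgP (@cvg_Fprod t).
Qed.

Lemma phi_ge0 t : 0 <= phi t.
Proof.
apply: limr_ge; first exact: cvgP (@cvg_Fprod t).
by near=> n; apply: Fprod_ge0.
Unshelve. all: by end_near. Qed.

Lemma phi_split n t : phi t = Fprod n t * phi (t / b%:R ^+ n).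
Proof.
have h : Fprod (k + n) t @[k --> \oo] --> Fprod n t * phi (t / b%:R ^+ n).
  under eq_fun do rewrite addnC FprodD.
  apply: cvgMl_tmp; exact: cvg_Fprod.
apply: cvg_unique h => //.
by have := @cvg_Fprod t; rewrite -(cvg_shiftn n).
Qed.

Lemma sum_inv_expn_le1 n : \sum_(j < n) (b%:R ^+ j.+1)^-1 <= 1 :> R.
Proof.
(* The induction needs this sharper bound; its step uses 2 / b <= 1. *)
suff : \sum_(j < n) (b%:R ^+ j.+1)^-1 <= 1 - (b%:R ^+ n)^-1 :> R.
  by move/le_trans; apply; rewrite gerBl invr_ge0 ltW.
elim: n => [|n IH]; first by rewrite big_ord0 expr0 invr1 subrr.
rewrite big_ord_recr /=; apply: le_trans (lerD IH (lexx _)) _.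
have h : 2 * (b%:R ^+ n.+1)^-1 <= (b%:R ^+ n)^-1 :> R.
  by rewrite exprS invfM mulrA -[leRHS]mul1r ler_pM2r ?invr_gt0 //
    ler_pdivrMr // mul1r ler_nat.
set x := (_ ^+ _.+1)^-1 in h *; set y := (_ ^+ _)^-1 in h *; lra.
Qed.

(** The scaling by b ^ (j + 1) makes the Lipschitz constants of the factors summable, so the bound
    is uniform in n and passes to [phi]. *)
Lemma dist_Fprod_le n s t : `|Fprod n s - Fprod n t| <= gfun_lip b * `|s - t|.
Proof.
apply: le_trans (dist_prod_le _ _ _) _ => [j|j|].
- by rewrite gfun_ge0 gfun_le1.
- by rewrite gfun_ge0 gfun_le1.
apply: (@le_trans _ _ (\sum_(j < n)
  gfun_lip b * `|s - t| * (b%:R ^+ j.+1)^-1)).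
  apply: ler_sum => j _; apply: le_trans (dist_gfun_le p_ge0 p_sum1 _ _) _.
  rewrite -mulrBl normrM mulrA.
  by rewrite (@ger0_norm _ (_ ^-1)) // invr_ge0 ltW.
rewrite -mulr_sumr ler_piMr ?sum_inv_expn_le1 // mulr_ge0 //.
exact: gfun_lip_ge0.
Qed.

Lemma dist_phi_le s t : `|phi s - phi t| <= gfun_lip b * `|s - t|.
Proof.
have h : `|Fprod n s - Fprod n t| @[n --> \oo] --> `|phi s - phi t|.
  by apply: cvg_norm; apply: cvgB; exact: cvg_Fprod.
rewrite -(cvg_lim _ h) //; apply: limr_le; first exact: cvgP h.
by near=> n; apply: dist_Fprod_le.
Unshelve. all: by end_near. Qed.

Lemma phi0 : phi 0 = 1.
Proof.
rewrite /phi; under eq_fun do rewrite -Sfun_Fprod mul0r Sfun_at0 //.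
exact: lim_cst.
Qed.

Lemma phi_gt0_near0 : exists J, forall t, 0 <= t <= 1 ->
  0 < phi (t / b%:R ^+ J).
Proof.
(* With K the Lipschitz constant and J = [Num.bound K] one has K < 2 ^ J, so [phi] at t / b ^ J
   differs from [phi 0 = 1] by less than 1. *)
exists (Num.bound (gfun_lip b : R)) => t /andP[t0 t1].
set J := Num.bound _.
have K2 : (gfun_lip b : R) < b%:R ^+ J.
  apply: (@lt_le_trans _ _ (2 ^+ J)); first exact: upper_nthrootP.
  by rewrite lerXn2r ?nnegrE ?ler_nat.
have := dist_phi_le (t / b%:R ^+ J) 0.
rewrite phi0 subr0 (ger0_norm (divr_ge0 t0 (ltW (bRX_gt0 J)))) => h.
have : gfun_lip b * (t / b%:R ^+ J) < 1.
  rewrite mulrA ltr_pdivrMr // mul1r; apply: le_lt_trans K2.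
  by rewrite ler_piMr // gfun_lip_ge0.
by move: h; rewrite ler_norml => /andP[h _]; lra.
Qed.

(** Zeros of [gfun] give roots on the unit circle of a polynomial of size at most b, which is
    nonzero because its value at 1 is 1. *)
Lemma count_gfun_eq0 n (f : 'I_n -> R) : injective f ->
  (forall i, f i \in `[0, 1[) ->
  \sum_(i < n) ((gfun p (f i) == 0)%:R : R) <= b%:R.
Proof.
move=> finj f01.
pose c r : R[i] := if insub r is Some k then (p k)%:C%C else 0.
pose P := \poly_(j < b) c j.
have PE x : P.[e x] = digit_char p x.
  by rewrite horner_poly; apply: eq_bigr => j _; rewrite /c valK eM_nat.
have P0 : P != 0.
  apply/eqP => P0; have := PE 0; rewrite P0 horner0 digit_char0 // => /eqP.
  by rewrite eq_sym oner_eq0.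
pose A := [pred i : 'I_n | gfun p (f i) == 0].
rewrite -natr_sum ler_nat.
have -> : (\sum_(i < n) (gfun p (f i) == 0%R))%N = #|A|.
  by rewrite -sum1_card [RHS]big_mkcond /=; apply: eq_bigr => i _; rewrite inE; case: eqP.
rewrite cardE -(size_map (fun i => e (f i))).
apply/ltnW/(leq_trans _ (size_poly b c))/max_poly_roots => //.
  rewrite all_map; apply/allP => i; rewrite mem_enum inE /= gfunE cmod_eq0.
  by move=> /eqP fi; rewrite rootE PE fi.
rewrite map_inj_in_uniq ?enum_uniq // => i j _ _.
by move/(e_inj (f01 i) (f01 j))/finj.
Qed.

Hypothesis p_nonunif : p <> (fun=> b%:R^-1).

(* For large [k] the at least [2 ^ k] indices [a] with
   [Sfun p k ((u + a) / b ^ k) != 0] outnumber those at which the remaining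
   factor [phi ((u + a) / b ^ k)] can vanish. *)
Lemma sum_phi_gt0 : exists k, forall u, 0 <= u <= 1 ->
  0 < \sum_(a < b ^ k) phi (u + a%:R).
Proof.
have [J phiJ] := phi_gt0_near0.
(* Each of J factors has at most b zeros among the points considered, and J b < 2 ^ (J b). *)
exists (J * b)%N; set k := (J * b)%N => u /andP[u0 u1].
rewrite lt_def sumr_ge0 ?andbT; last by move=> a _; apply: phi_ge0.
apply/eqP => S0; have Sz := psumr_eq0P (fun a _ => phi_ge0 _) S0.
pose t (a : 'I_(b ^ k)) := (u + a%:R) / b%:R ^+ k.
have t01 a : 0 <= t a <= 1.
  rewrite divr_ge0 ?addr_ge0 ?(ltW (bRX_gt0 k)) //= ler_pdivrMr // mul1r.
  rewrite -natrX; apply: (@le_trans _ _ (1 + a%:R)); first by rewrite lerD2r.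
  by rewrite addrC natr1 ler_nat.
have tinj : injective t.
  move=> a a' /(mulIf (invr_neq0 (bRX_neq0 k)))/addrI/eqP.
  by rewrite eqr_nat => /eqP/val_inj.
(* If S_k is nonzero at t a, the zero of [phi] at u + a comes from [phi (t a)], hence from one of
   its first J factors. *)
have le1 a : ((Sfun p k (t a) != 0)%:R : R) <=
    \sum_(j < J) ((gfun p (t a / b%:R ^+ j.+1) == 0)%:R : R).
  have sum0 : 0 <= \sum_(j < J) ((gfun p (t a / b%:R ^+ j.+1) == 0)%:R : R).
    by apply: sumr_ge0.
  have [//|Sn0 /=] := eqVneq (Sfun p k (t a)) 0.
  have := Sz a isT; rewrite (phi_split k) -Sfun_Fprod => /eqP.
  rewrite mulf_eq0 (negbTE Sn0) /= (phi_split J) mulf_eq0.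
  rewrite (gt_eqF (phiJ _ (t01 a))) orbF /Fprod.
  move=> /prodf_eq0 [j _ gj]; rewrite (bigD1 j) //= gj lerDl.
  by apply: sumr_ge0.
have := count_Sfun_neq0 hb p_ge0 p_sum1 p_nonunif k u.
rewrite leNgt => /negP; apply.
apply: (@le_lt_trans _ _ (\sum_(a < b ^ k) \sum_(j < J)
    ((gfun p (t a / b%:R ^+ j.+1) == 0)%:R : R))).
  by apply: ler_sum => a _; exact: le1.
rewrite exchange_big /=.
apply: (@le_lt_trans _ _ (\sum_(j < J) b%:R)).
  apply: ler_sum => j _.
  apply: (count_gfun_eq0 (f := fun a => t a / b%:R ^+ j.+1)) => [a a'|a].
    by move/(mulIf (invr_neq0 (bRX_neq0 _)))/tinj.
  (* t a may equal 1; dividing by b ^ (j + 1) moves it into the half-open interval on which [e] is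
     injective. *)
  have /andP[ta0 ta1] := t01 a.
  rewrite in_itv /= divr_ge0 ?(ltW (bRX_gt0 _)) //= ltr_pdivrMr // mul1r.
  apply: le_lt_trans ta1 _; rewrite -natrX ltr1n.
  by apply: leq_trans hb _; rewrite -{1}[b]expn1 leq_exp2l.
rewrite sumr_const card_ord -[b%:R *+ _]mulr_natl -natrM -natrX ltr_nat.
exact: ltn_expl.
Qed.

(** Continuity on the compact interval [0, 1] makes the positivity uniform. *)
Lemma sum_phi_ge : exists k (c : R), 0 < c /\ forall u, 0 <= u <= 1 ->
  c <= \sum_(a < b ^ k) phi (u + a%:R).
Proof.
have [k kP] := sum_phi_gt0.
pose f u := \sum_(a < b ^ k) phi (u + a%:R).
have fc : continuous f.
  apply: (@lipschitz_continuous _ (\sum_(a < b ^ k) gfun_lip b)) => x y.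
  rewrite /f -sumrB mulr_suml; apply: le_trans (ler_norm_sum _ _ _) _.
  apply: ler_sum => a _; apply: le_trans (dist_phi_le _ _) _.
  by rewrite opprD addrACA subrr addr0.
have [|c c01 cP] := @EVT_min R f 0 1 ler01.
  exact: continuous_subspaceT.
exists k, (f c); split; first by apply: kP; rewrite in_itv in c01.
by move=> u u01; apply: cP; rewrite in_itv.
Qed.

End infinite_product.

(** * Fourier coefficients of the digit distribution *)

Section characteristic_function.
Context {R : realType} (b : nat) (p : 'I_b -> R).
Hypothesis p_sum1 : \sum_(k < b) p k = 1.
Context (d : measure_display) (T : measurableType d) (P : probability T R).
Variable xi : nat -> {RV P >-> R}.
Hypothesis xi_indep : mutually_independent xi.
Hypothesis xi_distr : forall (j : nat) (k : 'I_b),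
  P (xi j @^-1` [set (k : nat)%:R]) = (p k)%:E.

Let measurable_digit j (k : nat) : measurable (xi j @^-1` [set k%:R]).
Proof.
by rewrite -[X in measurable X]setTI; apply: measurable_funP.
Qed.

Definition digits (n : nat) (k : {ffun 'I_n -> 'I_b}) : set T :=
  \bigcap_(j in [set: 'I_n]) xi j @^-1` [set (k j : nat)%:R].

Lemma measurable_digits n (k : {ffun 'I_n -> 'I_b}) : measurable (digits k).
Proof. by apply: fin_bigcap_measurable => // j _; apply: measurable_digit. Qed.

Lemma probability_digits n (k : {ffun 'I_n -> 'I_b}) :
  P (digits k) = (\prod_(j < n) p (k j))%:E.
Proof.
(* Independence takes a set for every index; from n on it is the whole line. *)
pose B (j : nat) : set R :=
  if insub j is Some i then [set (k i : nat)%:R] else setT.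
have mB j : measurable (B j) by rewrite /B; case: insubP.
have := xi_indep [fset j in index_iota 0 n]%fset mB.
have -> : \bigcap_(i in [set` [fset j in index_iota 0 n]%fset]) xi i @^-1` B i =
    digits k.
  apply/seteqP; split=> w /= H j /=.
    move=> _; have := H (j : nat); rewrite /= !inE mem_index_iota /= ltn_ord.
    by move/(_ isT); rewrite /B valK.
  rewrite !inE mem_index_iota /= => jn; have := H (Ordinal jn) I.
  by rewrite /B insubT.
move=> ->.
have pe : perm_eq [fset j in index_iota 0 n]%fset (index_iota 0 n).
  by apply: uniq_perm; rewrite ?fset_uniq ?iota_uniq // => j; rewrite !inE.
rewrite (perm_big _ pe) /= big_mkord -prodEFin.
by apply: eq_bigr => j _; rewrite /B valK xi_distr.
Qed.

(** The prescribed masses of the b digits add up to 1, leaving none for other values. *)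
Lemma digit_ae j : {ae P, forall w, exists k : 'I_b, xi j w = (k : nat)%:R}.
Proof.
pose A := \big[setU/set0]_(k < b) (xi j @^-1` [set (k : nat)%:R]).
have mA : measurable A by apply: bigsetU_measurable => k _; apply: measurable_digit.
have PA : P A = 1%E.
  rewrite measure_bigsetU_ord //=; last first.
    apply/trivIsetP => i k _ _ ik; apply/seteqP; split=> w //= [-> /eqP].
    by rewrite eqr_nat => /eqP/val_inj/eqP; rewrite (negbTE ik).
  by under eq_bigr do rewrite xi_distr; rewrite sumEFin p_sum1.
exists (~` A); split; first exact: measurableC.
  by rewrite probability_setC // PA subee.
move=> w /= Hw Aw; apply: Hw; move: Aw; rewrite /A.
by elim/big_rec: _ => // k B _ IH [kw|/IH //]; exists k.
Qed.

Definition partial_sum (n : nat) (w : T) : R :=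
  \sum_(j < n) xi j w / b%:R ^+ j.+1.

Lemma measurable_partial_sum n : measurable_fun setT (partial_sum n).
Proof.
apply: measurable_sum => j; apply: measurable_funM => //.
Qed.

Lemma integrable_bounded1 (h : R -> R) (f : T -> R) : measurable_fun setT f ->
  continuous h -> (forall x, `|h x| <= 1) ->
  P.-integrable setT (EFin \o (h \o f)).
Proof.
move=> mf hc h1.
have PT : (P setT < +oo)%E by rewrite probability_setT ltry.
apply: measurable_bounded_integrable => //.
- by apply: measurableT_comp => //; apply: continuous_measurable_fun.
- exists 1; split => // x x1 w _; apply: le_trans (h1 _) _; exact: ltW.
Qed.

Lemma integral_partial_sum (h : R -> R) n : continuous h ->
  (forall x, `|h x| <= 1) ->
  (\int[P]_w (h (partial_sum n w))%:E)%E =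
  (\sum_(k : {ffun 'I_n -> 'I_b}) (\prod_(j < n) p (k j)) *
     h (\sum_(j < n) (k j)%:R / b%:R ^+ j.+1))%:E.
Proof.
move=> hc h1.
pose x (k : {ffun 'I_n -> 'I_b}) : R := \sum_(j < n) (k j)%:R / b%:R ^+ j.+1.
have ik (k : {ffun 'I_n -> 'I_b}) :
    P.-integrable setT (fun w => (h (x k))%:E * (\1_(digits k) w)%:E)%E.
  by apply: integrableZl => //; apply: integrable_indic; apply: measurable_digits.
(* Almost surely every [xi j] is a digit, and then exactly one event [digits k] occurs. *)
transitivity (\int[P]_w
    (\sum_(k : {ffun 'I_n -> 'I_b}) (h (x k))%:E * (\1_(digits k) w)%:E))%E.
  apply: ae_eq_integral => //.
  - by have /measurable_int := integrable_bounded1 (@measurable_partial_sum n) hc h1.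
  - by apply: emeasurable_sum => k; have /measurable_int := ik k.
  have := ae_foralln digit_ae; apply: filterS => w Hw _.
  have [k0 k0P] := choice Hw.
  pose k : {ffun 'I_n -> 'I_b} := [ffun j : 'I_n => k0 j].
  have kw (k' : {ffun 'I_n -> 'I_b}) : (w \in digits k') = (k' == k).
    apply/idP/eqP => [|->]; rewrite in_setE.
      move=> H; apply/ffunP => j; rewrite ffunE; apply/val_inj/eqP.
      by rewrite -(eqr_nat R) -k0P; apply/eqP/esym/(H j).
    by move=> j _ /=; rewrite ffunE.
  rewrite (bigD1 k) //= big1 => [|k' k'k]; last first.
    by rewrite indicE kw (negbTE k'k) mule0.
  rewrite indicE kw eqxx mule1 adde0; congr (h _)%:E.
  by apply: eq_bigr => j _; rewrite k0P ffunE.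
rewrite integral_sum // -sumEFin; apply: eq_bigr => k _.
rewrite integralZl //; last by apply: integrable_indic; apply: measurable_digits.
rewrite integral_indic //; last exact: measurable_digits.
transitivity ((h (x k))%:E * P (digits k))%E; first by rewrite setIT.
by rewrite probability_digits -EFinM mulrC.
Qed.

Variable X : {RV P >-> R}.
Hypothesis X_sum : {ae P, forall w,
  series (fun j : nat => xi j w / b%:R ^+ j.+1) @ \oo --> X w}.

(** Dominated convergence with majorant 1, combined with the change of variables to the law of
    [X]. *)
Lemma cvg_integral_partial_sum (h : R -> R) : continuous h ->
  (forall x, `|h x| <= 1) ->
  Rintegral P setT (fun w => h (partial_sum n w)) @[n --> \oo] -->
  Rintegral (distribution P X) setT h.
Proof.
move=> hc h1.
have iX := integrable_bounded1 (measurable_funP X) hc h1.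
have -> : Rintegral (distribution P X) setT h = Rintegral P setT (h \o X).
  rewrite /Rintegral /distribution; congr fine.
  have mh : measurable_fun setT (EFin \o h).
    by apply/measurable_EFinP; exact: continuous_measurable_fun hc.
  rewrite (integral_pushforward (measurable_funP X) mh) //.
have mh n := measurable_int _
  (integrable_bounded1 (@measurable_partial_sum n) hc h1).
have i1 : P.-integrable setT (EFin \o cst 1).
  exact: finite_measure_integrable_cst.
have [||_ _] := dominated_convergence measurableT mh (measurable_int _ iX) _ i1 _.
- move: X_sum; apply: filterS => w Xw _.
  have c1 : partial_sum n w @[n --> \oo] --> X w.
    have -> : partial_sum ^~ w = series (fun j : nat => xi j w / b%:R ^+ j.+1).
      by apply/funext => n; rewrite /series /= big_mkord.
    exact: Xw.
  apply: cvg_EFin; first exact: nearW.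
  exact: (cvg_comp _ _ c1 (hc _)).
- by apply: aeW => w n _; rewrite /= lee_fin h1.
move=> cvI; rewrite /Rintegral; apply: fine_cvg; rewrite fineK //.
exact: integrable_fin_num iX.
Qed.

Lemma complex_sum (I : Type) (r : seq I) (F : I -> R[i]) :
  \sum_(i <- r) F i =
  Complex (\sum_(i <- r) complex.Re (F i)) (\sum_(i <- r) complex.Im (F i)).
Proof.
elim: r => [|i r IH]; first by rewrite !big_nil.
by rewrite !big_cons IH; case: (F i).
Qed.

Lemma prod_digit_char n (y : R) :
  \prod_(j < n) digit_char p (y / b%:R ^+ j.+1) =
  \sum_(k : {ffun 'I_n -> 'I_b}) (\prod_(j < n) p (k j))%:C%C *
    e (y * \sum_(j < n) (k j)%:R / b%:R ^+ j.+1).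
Proof.
rewrite /digit_char bigA_distr_bigA /=; apply: eq_bigr => k _.
rewrite big_split /= rmorph_prod; congr (_ * _).
rewrite mulr_sumr e_sum; apply: eq_bigr => j _; congr e.
by rewrite mulrCA.
Qed.

(** For n digits, the cosine and sine integrals are the real and imaginary parts of the sum in
    [prod_digit_char], whose modulus is [Fprod p n k]; then n tends to infinity. The sign in y is
    removed by [gfunN]. *)
Lemma cmod_fourier (k : nat) :
  cmod (fourier (distribution P X) k%:Z) = phi p k%:R.
Proof.
pose y : R := - k%:R.
have yE x : - ((k%:Z)%:~R * x) = y * x by rewrite mulNr.
pose hc x := cos (2 * pi * (y * x)); pose hs x := sin (2 * pi * (y * x)).
have lip x z : `|2 * pi * (y * x) - 2 * pi * (y * z)| =
    `|2 * pi * y| * `|x - z|.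
  by rewrite -normrM; congr (`|_|); ring.
have hcc : continuous hc.
  apply: (@lipschitz_continuous _ `|2 * pi * y|) => x z.
  by rewrite -lip dist_cos_le.
have hsc : continuous hs.
  apply: (@lipschitz_continuous _ `|2 * pi * y|) => x z.
  by rewrite -lip dist_sin_le.
have hc1 x : `|hc x| <= 1 by rewrite ler_norml cos_geN1 cos_le1.
have hs1 x : `|hs x| <= 1 by rewrite ler_norml sin_geN1 sin_le1.
have cc := cvg_integral_partial_sum hcc hc1.
have cs := cvg_integral_partial_sum hsc hs1.
have fE : cmod (fourier (distribution P X) k%:Z) =
    Num.sqrt (Rintegral (distribution P X) setT hc ^+ 2 +
              Rintegral (distribution P X) setT hs ^+ 2).
  rewrite cmodE /fourier /Cintegral /=.
  have -> : hc = fun x => cos (2 * pi * - ((k%:Z)%:~R * x)).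
    by apply/funext => x; rewrite yE.
  have -> // : hs = fun x => sin (2 * pi * - ((k%:Z)%:~R * x)).
  by apply/funext => x; rewrite yE.
have FE n : Fprod p n k%:R =
    Num.sqrt (Rintegral P setT (fun w => hc (partial_sum n w)) ^+ 2 +
              Rintegral P setT (fun w => hs (partial_sum n w)) ^+ 2).
  rewrite /Rintegral !integral_partial_sum //=.
  transitivity (cmod (\prod_(j < n) digit_char p (y / b%:R ^+ j.+1))).
    rewrite cmod_prod; apply: eq_bigr => j _.
    by rewrite -gfunE -gfunN mulNr.
  rewrite prod_digit_char complex_sum cmodE /=.
  congr (Num.sqrt (_ ^+ 2 + _ ^+ 2)); apply: eq_bigr => f _.
    by rewrite mul0r subr0.
  by rewrite mul0r addr0.
have h : Fprod p n k%:R @[n --> \oo] -->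
    cmod (fourier (distribution P X) k%:Z).
  rewrite fE; under eq_fun do rewrite FE.
  apply: continuous_cvg; first exact: sqrt_continuous.
  by apply: cvgD; apply: cvgM.
by rewrite /phi (cvg_lim _ h).
Qed.

End characteristic_function.

(** * Bounds on the exponent *)

Lemma geometric_bounded_le1 {R : realType} (rho C : R) : 0 <= rho ->
  (forall n, rho ^+ n <= C) -> rho <= 1.
Proof.
move=> rho0 rhoC; rewrite leNgt; apply/negP => rho1.
(* Bernoulli's inequality: for rho > 1 the powers grow at least linearly. *)
have bern n : 1 + n%:R * (rho - 1) <= rho ^+ n.
  elim: n => [|n IH]; first by rewrite mul0r addr0 expr0.
  have n0 : 0 <= (n%:R : R) by [].
  rewrite exprSr; apply: le_trans (ler_wpM2r rho0 IH).
  by have := mulr_ge0 n0 (sqr_ge0 (rho - 1)); rewrite -natr1; nra.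
pose n := Num.bound (C / (rho - 1)).
have r1 : 0 < rho - 1 by rewrite subr_gt0.
have : C / (rho - 1) < n%:R by apply: unstable.ltr_bound.
rewrite ltr_pdivrMr // => Cn.
by have := le_trans (bern n) (rhoC n); lra.
Qed.

(** Turns the growth factor B M of the sums into B ^ (1 - s), where s is the candidate exponent. *)
Lemma mul_powR_ln {R : realType} (B M : R) : 1 < B -> 0 < M ->
  B * M = B `^ (1 - (- ln M / ln B)).
Proof.
move=> B1 M0; have B0 : 0 < B by apply: lt_trans B1.
have lB : 0 < ln B by rewrite ln_gt0.
rewrite /powR gt_eqF //.
have -> : (1 - - ln M / ln B) * ln B = ln B + ln M by field; rewrite gt_eqF.
by rewrite expRD !lnK.
Qed.

Lemma powR_expn {R : realType} (B x : R) n : 0 <= B ->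
  (B `^ x) ^+ n = (B ^+ n) `^ x.
Proof.
by move=> B0; rewrite -powR_mulrn ?powR_ge0 // powRAC powR_mulrn.
Qed.

Section bounds.
Context {R : realType} (b : nat) (p : 'I_b -> R).
Hypotheses (hb : (2 <= b)%N) (p_ge0 : forall k, 0 <= p k).
Hypothesis p_sum1 : \sum_(k < b) p k = 1.
Hypothesis p_nonunif : p <> (fun=> b%:R^-1).

Let b_gt0 : (0 < b)%N. Proof. exact: ltnW. Qed.
Let bR_gt0 : 0 < (b%:R : R). Proof. by rewrite ltr0n. Qed.
Let bRX_gt0 L : 0 < (b%:R ^+ L : R). Proof. by rewrite exprn_gt0. Qed.
Let bRX_neq0 L : (b%:R ^+ L : R) != 0. Proof. by rewrite gt_eqF. Qed.
Let bRX_gt1 L : (1 <= L)%N -> 1 < (b%:R ^+ L : R).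
Proof. by move=> L1; rewrite exprn_egt1 ?ltr1n // -lt0n. Qed.

Lemma sum_phi_le_avgS n :
  \sum_(i < b ^ n) phi p i%:R <= b%:R ^+ n * avgS p n 0.
Proof.
rewrite /avgS mulVKf //; apply: ler_sum => i _.
by rewrite add0r Sfun_Fprod //; apply: phi_le_Fprod.
Qed.

(** For the index i + b ^ n j, the factor S_n (i / b ^ n) splits off, and the sum over j is at least
    c, taking u = i / b ^ n. *)
Lemma avgS_le_sum_phi k c n :
  (forall u, 0 <= u <= 1 -> c <= \sum_(a < b ^ k) phi p (u + a%:R)) ->
  c * (b%:R ^+ n * avgS p n 0) <= \sum_(i < b ^ (n + k)) phi p i%:R.
Proof.
move=> kc; rewrite /avgS mulVKf // expnD.
rewrite (sum_ord_mul _ _ (fun i => phi p i%:R)) exchange_big /= mulr_sumr.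
apply: ler_sum => i _; rewrite add0r.
have u01 : 0 <= (i%:R / b%:R ^+ n : R) <= 1.
  rewrite divr_ge0 ?(ltW (bRX_gt0 n)) //= ler_pdivrMr // mul1r -natrX.
  by rewrite ler_nat ltnW.
apply: le_trans (ler_wpM2r (Sfun_ge0 p n _) (kc _ u01)) _.
rewrite mulr_suml; apply: ler_sum => j _.
rewrite [leRHS](phi_split hb p_ge0 p_sum1 n) -Sfun_Fprod //.
have -> : (i + b ^ n * j)%:R / b%:R ^+ n = i%:R / b%:R ^+ n + j%:R :> R.
  by rewrite natrD natrM natrX; field.
by rewrite SfunDn mulrC.
Qed.

Variable nu : probability R R.
Hypothesis nu_phi : forall k : nat, cmod (fourier nu k%:Z) = phi p k%:R.

Let sum_fourier Q : \sum_(0 <= i < Q) cmod (fourier nu i%:Z) =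
  \sum_(i < Q) phi p i%:R.
Proof. by rewrite big_mkord; apply: eq_bigr => i _; rewrite nu_phi. Qed.

Let sum_phi_homo n m : (n <= m)%N ->
  \sum_(i < n) phi p i%:R <= \sum_(i < m) phi p i%:R.
Proof.
move=> nm; rewrite -!(big_mkord xpredT (fun i => phi p i%:R)).
rewrite (big_cat_nat _ nm) //= lerDl.
by apply: sumr_ge0 => i _; apply: phi_ge0.
Qed.

Lemma kappa1_ge L M : (1 <= L)%N -> is_max (avgS p L) M ->
  ((- ln M / ln (b%:R ^+ L))%:E <= kappa1 nu)%E.
Proof.
move=> L1 [[x0 x0M] leM]; set B := b%:R ^+ L; set s := - ln M / ln B.
have B1 : 1 < B := bRX_gt1 L1.
have B0 : 0 < B := bRX_gt0 L.
have M1 : M <= 1 by rewrite -x0M avgS_le1.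
(* This gives s <= 1, so that Q ^ (1 - s) is nondecreasing in Q. *)
have BM : B^-1 <= M by apply: le_trans (leM 0); apply: avgS0_ge.
have M0 : 0 < M by apply: lt_le_trans BM; rewrite invr_gt0.
have lB : 0 < ln B by rewrite ln_gt0.
have s0 : 0 <= s by rewrite divr_ge0 ?oppr_ge0 ?ln_le0 // ltW.
have s1 : 0 <= 1 - s.
  rewrite subr_ge0 ler_pdivrMr // mul1r -lnV ?posrE //.
  by rewrite ler_ln ?posrE ?invr_gt0 // -[leRHS]invrK lef_pV2 ?posrE ?invr_gt0.
apply: ereal_sup_ubound; exists s => //; split=> //; exists (B * M) => Q Q1.
have bL1 : (1 < b ^ L)%N by rewrite -(ltr_nat R) natrX.
(* Here B ^ n <= Q < B ^ (n + 1), so 0, ..., Q all lie below B ^ (n + 1). The extra factor in (B M)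
   ^ (n + 1) is the constant B M. *)
have /andP[Q2 Q3] := trunc_log_bounds bL1 Q1.
set n := trunc_log _ _ in Q2 Q3.
rewrite sum_fourier; apply: (le_trans (sum_phi_homo Q3)).
rewrite -expnM; apply: (le_trans (sum_phi_le_avgS _)).
apply: (@le_trans _ _ ((B * M) ^+ n.+1)).
  rewrite exprMn -exprM ler_pM2l ?exprn_gt0 //.
  exact: avgS_mul_le.
rewrite exprS ler_pM2l ?mulr_gt0 //.
rewrite {1}(mul_powR_ln B1 M0) powR_expn ?(ltW B0) //.
apply: ge0_ler_powR => //; rewrite ?nnegrE ?exprn_ge0 ?(ltW B0) //.
by rewrite /B -natrX -natrX ler_nat.
Qed.

(** For an admissible s, the powers of B m / B ^ (1 - s) stay bounded, so this ratio is at most 1;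
    taking logarithms bounds s. *)
Lemma kappa1_le L m : (1 <= L)%N -> is_min (avgS p L) m ->
  (kappa1 nu <= (- ln m / ln (b%:R ^+ L))%:E)%E.
Proof.
move=> L1 [[x0 x0m] gem]; set B := b%:R ^+ L.
have B1 : 1 < B := bRX_gt1 L1.
have B0 : 0 < B := bRX_gt0 L.
have m0 : 0 < m by rewrite -x0m avgS_gt0.
have lB : 0 < ln B by rewrite ln_gt0.
apply: ub_ereal_sup => _ [s [s0 [C HC]] <-]; rewrite lee_fin.
have [k [c [c0 kc]]] := sum_phi_ge hb p_ge0 p_sum1 p_nonunif.
(* Testing at Q = b ^ (L n + k) costs b ^ (k (1 - s)) and 1 / c, both independent of n. *)
set D := C * (b%:R ^+ k) `^ (1 - s) / c.
have P0 : 0 < B `^ (1 - s) by rewrite powR_gt0.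
have rhoD n : (B * m / B `^ (1 - s)) ^+ n <= D.
  rewrite expr_div_n ler_pdivrMr ?exprn_gt0 // /D mulrAC ler_pdivlMr // mulrC.
  apply: (@le_trans _ _ (c * (b%:R ^+ (L * n) * avgS p (L * n) 0))).
    rewrite ler_pM2l // exprMn -exprM ler_pM2l ?exprn_gt0 //.
    by apply: avgS_mul_ge; rewrite ?ltW.
  apply: le_trans (avgS_le_sum_phi _ kc) _.
  have Q1 : (1 <= b ^ (L * n + k))%N by rewrite expn_gt0 b_gt0.
  have := HC _ Q1; rewrite sum_fourier.
  move/(le_trans (sum_phi_homo (leqnSn _)))/le_trans; apply.
  rewrite natrX exprD powRM ?exprn_ge0 ?(ltW bR_gt0) //.
  by rewrite powR_expn ?(ltW B0) // -exprM [_ `^ _ * _]mulrC mulrA.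
have : B * m / B `^ (1 - s) <= 1.
  by apply: geometric_bounded_le1 rhoD; rewrite !mulr_ge0 ?invr_ge0 ?ltW.
rewrite ler_pdivrMr // mul1r -ler_ln ?posrE ?mulr_gt0 // lnM ?posrE // ln_powR.
by rewrite ler_pdivlMr //; lra.
Qed.

(** [avgS_le_avgS] bounds M / m by a constant times L. Estimating the logarithm by a square root
    weakens the rate to L ^ (-1 / 2), which still tends to 0. *)
Lemma bound_gap L M m : (1 <= L)%N -> is_max (avgS p L) M ->
  is_min (avgS p L) m ->
  - ln m / ln (b%:R ^+ L) - (- ln M / ln (b%:R ^+ L)) <=
  2 * Num.sqrt (8 * (1 + ln b%:R)) / ln b%:R * Num.sqrt L%:R^-1.
Proof.
move=> L1 [[x0 x0M] leM] [[z0 z0m] gem].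
have be0 : 0 < ln (b%:R : R) by rewrite ln_gt0 // ltr1n.
have m0 : 0 < m by rewrite -z0m avgS_gt0.
have M0 : 0 < M by rewrite -x0M avgS_gt0.
have L0 : 0 < (L%:R : R) by rewrite ltr0n.
have L1R : 1 <= (L%:R : R) by rewrite ler1n.
set be := ln b%:R in be0 *.
have lnB : ln (b%:R ^+ L) = L%:R * be by rewrite lnXn // mulr_natl.
rewrite lnB.
have -> : - ln m / (L%:R * be) - (- ln M / (L%:R * be)) =
    (ln M - ln m) / (L%:R * be) by field; rewrite !gt_eqF.
have hM : M <= 8 * (1 + L%:R * be) * m.
  by rewrite -x0M -z0m -lnB; apply: avgS_le_avgS.
set y := 8 * (1 + be) * L%:R.
have y0 : 0 < y by rewrite !mulr_gt0 // ltr_wpDl.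
have ly : ln M - ln m <= 2 * Num.sqrt y.
  rewrite -ln_div ?posrE //; apply: (@le_trans _ _ (ln y)).
    rewrite ler_ln ?posrE ?divr_gt0 // ler_pdivrMr //; apply: le_trans hM _.
    rewrite ler_pM2r // /y; nra.
  have sy : 0 < Num.sqrt y by rewrite sqrtr_gt0.
  rewrite -{1}(sqr_sqrtr (ltW y0)) lnXn //.
  rewrite -[ln _ *+ 2]mulr_natl ler_pM2l //.
  (* ln y = 2 ln (sqrt y), and ln (1 + x) <= x at x = sqrt y - 1. *)
  have := @le_ln1Dx R (Num.sqrt y - 1); rewrite [1 + _]addrC subrK => h.
  by apply: le_trans (h _) _; lra.
rewrite ler_pdivrMr ?mulr_gt0 //; apply: le_trans ly _.
have y8 : 0 <= 8 * (1 + be) by lra.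
rewrite /y (sqrtrM _ y8) (sqrtrV (ltW L0)).
have sL : 0 < Num.sqrt (L%:R : R) by rewrite sqrtr_gt0.
rewrite le_eqVlt; apply/orP; left; apply/eqP.
have LE := sqr_sqrtr (ltW L0).
set q := Num.sqrt L%:R in sL LE *; rewrite -LE.
by field; rewrite !gt_eqF.
Qed.

End bounds.

Theorem theorem4p2 (R : realType) (b : nat) (hb : (2 <= b)%N)
  (p : 'I_b -> R) (p_ge0 : forall k, 0 <= p k) (p_sum1 : \sum_(k < b) p k = 1)
  (p_nonunif : p <> (fun=> b%:R^-1))
  (d : measure_display) (T : measurableType d) (P : probability T R)
  (xi : nat -> {RV P >-> R})
  (xi_indep : mutually_independent xi)
  (xi_distr : forall (j : nat) (k : 'I_b),
    P (xi j @^-1` [set (k : nat)%:R]) = (p k)%:E)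
  (X : {RV P >-> R})
  (* xi is indexed from 0, so xi j is the digit of weight b ^ -(j + 1) *)
  (X_sum : {ae P, forall w,
    series (fun j : nat => xi j w / b%:R ^+ j.+1) @ \oo --> X w}) :
  exists M m : nat -> R,
    [/\ forall L : nat, (1 <= L)%N ->
          is_max (avgS p L) (M L) /\ is_min (avgS p L) (m L),
        forall L : nat, (1 <= L)%N ->
          ((- ln (M L) / ln (b%:R ^+ L))%:E <= kappa1 (distribution P X))%E /\
          (kappa1 (distribution P X) <= (- ln (m L) / ln (b%:R ^+ L))%:E)%E
      & exists l : R,
          (fun L : nat => - ln (M L) / ln (b%:R ^+ L)) @ \oo --> l /\
          (fun L : nat => - ln (m L) / ln (b%:R ^+ L)) @ \oo --> l].
Proof.
have nu_phi := cmod_fourier p_sum1 xi_indep xi_distr X_sum.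
have [M MP] := choice (avgS_max hb p_ge0 p_sum1).
have [m mP] := choice (avgS_min hb p_ge0 p_sum1).
have lo L (L1 : (1 <= L)%N) := kappa1_ge hb p_ge0 p_sum1 nu_phi L1 (MP L).
have hi L (L1 : (1 <= L)%N) :=
  kappa1_le hb p_ge0 p_sum1 p_nonunif nu_phi L1 (mP L).
exists M, m; split=> [//|L L1|]; first by split; [exact: lo|exact: hi].
(* The bounds for L = 1 make [kappa1] finite; its value is the common limit. *)
have [l kl] : exists l, kappa1 (distribution P X) = l%:E.
  move: (lo 1%N isT) (hi 1%N isT).
  by case: (kappa1 _) => [l _ _|//|//]; exists l.
pose K : R := 2 * Num.sqrt (8 * (1 + ln b%:R)) / ln b%:R.
have gap L : (1 <= L)%N ->
    [/\ l - K * Num.sqrt L%:R^-1 <= - ln (M L) / ln (b%:R ^+ L) <= l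
      & l <= - ln (m L) / ln (b%:R ^+ L) <= l + K * Num.sqrt L%:R^-1].
  move=> L1; have := bound_gap hb p_ge0 p_sum1 p_nonunif L1 (MP L) (mP L).
  have := lo L L1; have := hi L L1; rewrite kl !lee_fin -/K.
  by move=> h1 h2 h3; split; apply/andP; split; lra.
have eps0 : K * Num.sqrt L.+1%:R^-1 @[L --> \oo] --> (0 : R).
  rewrite -(mulr0 K) -(sqrtr0 R); apply: cvgMl_tmp.
  apply: continuous_cvg; first exact: sqrt_continuous.
  exact: cvg_harmonic.
(* The bounds hold from L = 1 on, so both sequences are shifted by one index before squeezing. *)
exists l; split; rewrite -(cvg_shiftS _ (nbhs l)) /=.
  apply: (squeeze_cvgr (f := fun L => l - K * Num.sqrt L.+1%:R^-1)
                       (h := fun=> l)).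
  - by apply: nearW => L; have [] := gap L.+1 isT.
  - by rewrite -[X in _ --> X]subr0; apply: cvgB eps0; exact: cvg_cst.
  - exact: cvg_cst.
apply: (squeeze_cvgr (f := fun=> l)
                     (h := fun L => l + K * Num.sqrt L.+1%:R^-1)).
- by apply: nearW => L; have [] := gap L.+1 isT.
- exact: cvg_cst.
- by rewrite -[X in _ --> X]addr0; apply: cvgD eps0; exact: cvg_cst.
Qed.
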